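(* Let the matrix $A$ be invertible and let $f(x)=(A^{-1}F)^{T}G(x)$. Then the degenerate kernel Fredholm integral equation $Lu=f$ has the minimal-norm solution $$u^{\dagger}(t)=(H^{-1}A^{-1}F)^{T}H(t),$$ with $$\|u^{\dagger}\|_{L^{2}}^{2}=(A^{-1}F)^{T}H^{-1}(A^{-1}F).$$ Moreover, the structure of solutions of $Lu=f$ can be represented as $$u(t)=u^{\dagger}(t)+\sum_{i=1}^{\infty}c_i\varphi_i(t),$$ where the real sequences $\{c_i\}_{i=1}^{\infty}$ belong to $l^2$, i.e., $\sum_{i=1}^{\infty}c_i^2<+\infty$.
   Context: Let $E\subseteq D$ be measurable subsets of a Euclidean space, and let all functions be real-valued. Let $n\ge 1$, let $g_1,\dots,g_n\in L^2(D)$ be linearly independent and let $h_1,\dots,h_n\in L^2(E)$ be linearly independent. Write $G(x)=(g_1(x),\dots,g_n(x))^{T}$ and $H(t)=(h_1(t),\dots,h_n(t))^{T}$. Define the operator $L$ on $L^2(E)$ by $$L(u)(x)=\int_E k(x,t)u(t)\,dt,\qquad k(x,t)=\sum_{i=1}^{n}g_i(x)h_i(t)=G(x)^{T}H(t),\quad x\in D,$$ and let $N(L)\subseteq L^2(E)$ be its null space. The functions $\{\varphi_i(t)\}_{i=1}^{\infty}$ are assumed to be a basis in $N(L)$. Let $f\in L^2(D)$. The symbol $H$ without an argument denotes the $n\times n$ matrix $H=[h_{ij}]$ with $h_{ij}=\int_E h_i(t)h_j(t)\,dt$ (as opposed to the vector function $H(t)$). Also $A=[a_{ij}]$ is the $n\times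 n$ matrix with $a_{ij}=\int_E h_i(t)g_j(t)\,dt$, and $F=[f_k]$ is the column vector in $\mathbb{R}^n$ with $f_k=\int_E f(t)h_k(t)\,dt$. A function $u\in L^2(E)$ is a least-squares solution of $Lu=f$ if $\|Lu-f\|_{L^2(D)}=\inf\{\|Lv-f\|_{L^2(D)}: v\in L^2(E)\}$. With $S$ the set of least-squares solutions, the minimal-norm solution of $Lu=f$ is the element $u^{\dagger}\in S$ with $\|u^{\dagger}\|_{L^2(E)}=\inf_{u\in S}\|u\|_{L^2(E)}$.
   Formalization: The basis φ_i of N(L) is taken to be a Riesz basis (orthonormal bases included); for a general basis the l² claim fails, e.g. φ_i = e_i/i or φ_i = i·e_i with e_i an orthonormal basis of N(L). *)

(* Defs.v *)
(* MathComp-Analysis *)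
From HB Require Import structures.
From mathcomp Require Import all_boot all_order all_algebra.
From mathcomp Require Import all_classical all_reals all_analysis.

Set Implicit Arguments.
Unset Strict Implicit.
Unset Printing Implicit Defensive.
Import Order.TTheory GRing.Theory Num.Theory.
Import numFieldNormedType.Exports.

Local Open Scope classical_set_scope.
Local Open Scope ring_scope.

(* The Lebesgue measure on R^(d+1): the infimum of the total volumes of the
   countable covers by boxes, restricted to its Caratheodory-measurable sets.
   These are the Lebesgue-measurable sets (not only the Borel sets).  The
   dimension is written d.+1 because in R^0 no box would have volume 0. *)
Section LebesgueMeasure.
Context (R : realType) (d : nat).
Local Notation V := 'rV[R]_d.+1.
Local Open Scope ereal_scope.

Definition box (I : V * V) : set V :=
  [set x | forall i, (I.1 ord0 i < x ord0 i <= I.2 ord0 i)%R].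

Definition box_volume (I : V * V) : R :=
  (\prod_(i < d.+1) Num.max 0 (I.2 ord0 i - I.1 ord0 i))%R.

Definition box_cover (X : set V) : set (nat -> V * V) :=
  [set F | X `<=` \bigcup_k box (F k)].

Definition lebesgue_outer (X : set V) : \bar R :=
  ereal_inf [set \sum_(k <oo) (box_volume (F k))%:E | F in box_cover X].

Lemma box_volume_ge0 I : 0 <= (box_volume I)%:E.
Proof. by rewrite lee_fin prodr_ge0// => i _; rewrite le_max lexx. Qed.

Lemma lebesgue_outer_ge0 X : 0 <= lebesgue_outer X.
Proof.
apply: le_ereal_inf_tmp => _ [F _ <-].
by apply: nneseries_ge0 => k _ _; exact: box_volume_ge0.
Qed.

Lemma lebesgue_outer0 : lebesgue_outer set0 = 0.
Proof.
apply/eqP; rewrite eq_le lebesgue_outer_ge0 andbT.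
apply: ereal_inf_lbound; exists (fun=> (0%R, 0%R)) => //=.
by apply: eseries0 => k _ _; rewrite /box_volume big_ord_recl /= subrr maxxx mul0r.
Qed.

Lemma le_lebesgue_outer : {homo lebesgue_outer : A B / A `<=` B >-> A <= B}.
Proof.
move=> A B AB; apply: ereal_inf_le_tmp => _ [F BF <-].
by exists F => //; exact: subset_trans BF.
Qed.

Lemma lebesgue_outer_sigma_subadditive : sigma_subadditive lebesgue_outer.
Proof.
move=> A; have [[i ioo]|] := pselect (exists i, lebesgue_outer (A i) = +oo).
  rewrite (eseries_pinfty _ _ ioo) ?leey// => n _.
  by rewrite -ltNye (lt_le_trans _ (lebesgue_outer_ge0 _)).
rewrite -forallNE => Aoo.
suff add2e (e : {posnum R}) : lebesgue_outer (\bigcup_n A n) <=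
    \sum_(i <oo) lebesgue_outer (A i) + e%:num%:E.
  by apply/lee_addgt0Pr => _/posnumP[].
rewrite (le_trans _ (epsilon_trick _ _ _))//; last first.
  by move=> n; exact: lebesgue_outer_ge0.
pose P n (B : nat -> V * V) := box_cover (A n) B /\
  \sum_(k <oo) (box_volume (B k))%:E <=
    lebesgue_outer (A n) + (e%:num / (2 ^ n.+1)%:R)%:E.
have [G PG] : {G : nat -> nat -> V * V & forall n, P n (G n)}.
  apply: (@choice _ _ P) => n; rewrite /P /lebesgue_outer.
  set S := (X in ereal_inf X); move infS : (ereal_inf S) => iS.
  case: iS infS => [r Sr|Soo|Soo].
  - have en1 : (0 < e%:num / (2 ^ n.+1)%:R)%R by [].
    have /(lb_ereal_inf_adherent en1) : ereal_inf S \is a fin_num by rewrite Sr.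
    move=> [x [B AnB muBx] xS].
    by exists B; split => //; rewrite muBx -Sr; exact/ltW.
  - by have := Aoo n; rewrite /lebesgue_outer Soo.
  - by have := lebesgue_outer_ge0 (A n); rewrite /lebesgue_outer -/S Soo.
pose w (p : nat * nat) := (box_volume (G p.1 p.2))%:E.
have w0 p : 0 <= w p by exact: box_volume_ge0.
apply: (@le_trans _ _ (\esum_(i in setT) w i)).
  apply: ereal_inf_lbound => /=.
  have /card_esym/ppcard_eqP[f] := card_nat2.
  exists (fun k => G (f k).1 (f k).2).
    move=> t [i _] /(PG i).1[j _ Bijt]; exists (f^-1%FUN (i, j)) => //=.
    by rewrite invK ?inE.
  rewrite -(esum_pred_image w _ xpredT) ?[fun=> _]set_true//.
  by rewrite image_eq.
rewrite (_ : esum _ _ = \sum_(i <oo) \sum_(j <oo) w (i, j)); last first.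
  pose J : nat -> set (nat * nat) := fun i => [set (i, j) | j in setT].
  rewrite (_ : setT = \bigcup_k J k); last first.
    by rewrite predeqE => -[a b]; split => // _; exists a => //; exists b.
  rewrite esum_bigcupT /=; last 2 first.
    - apply/trivIsetP => i j _ _ ij.
      rewrite predeqE => -[n m] /=; split => //= -[] [_] _ [<-{n} _].
      by move=> [m' _] [] /esym/eqP; rewrite (negbTE ij).
    - by move=> *; exact: w0.
  rewrite -(image_id [set: nat]) -fun_true esum_pred_image//; last first.
    by move=> n _; exact: esum_ge0.
  apply: eq_eseriesr => /= j _.
  rewrite -(esum_pred_image w (pair j) predT)//=; last first.
    by move=> ? ? _ _; exact: (@can_inj _ _ _ snd).
  by congr esum; rewrite predeqE => -[a b]; split; move=> [i _ <-]; exists i.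
apply: lee_lim.
- apply: is_cvg_nneseries => n *.
  by apply: nneseries_ge0 => m *; exact: w0.
- by apply: is_cvg_nneseries => n *; apply: adde_ge0 => //; exact: lebesgue_outer_ge0.
- by near=> n; apply: lee_sum => i _; exact: (PG i).2.
Unshelve. all: by end_near. Qed.

HB.instance Definition _ := isOuterMeasure.Build R V lebesgue_outer
  lebesgue_outer0 lebesgue_outer_ge0 le_lebesgue_outer
  lebesgue_outer_sigma_subadditive.

End LebesgueMeasure.

Definition lebesgue_outer_measure (R : realType) (d : nat) :
    {outer_measure set 'rV[R]_d.+1 -> \bar R} := @lebesgue_outer R d.

(* R^(d+1) with the sigma-algebra of its Lebesgue-measurable sets *)
Notation euclid R d := (caratheodory_type (lebesgue_outer_measure R d)).

Definition leb (R : realType) (d : nat) :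
    {measure set (euclid R d) -> \bar R} :=
  (lebesgue_outer_measure R d : set (euclid R d) -> \bar R).

(* Elements of L^2(E) are represented by functions on the whole space of which
   only the values on E matter ([u \_ E] is u extended by 0 outside of E), and
   equality in L^2(E) is equality almost everywhere on E. *)
Section L2.
Context (disp : measure_display) (T : measurableType disp) (R : realType).
Variable mu : {measure set T -> \bar R}.
Implicit Types (D E : set T) (u f : T -> R).

Definition L2 E : set (T -> R) := [set u | (u \_ E) \in Lfun mu 2%:E].

Definition norm2 E u : R := fine ('N[mu]_2%:E[EFin \o (u \_ E)])%E.

Definition lin_indep E (n : nat) (h : 'I_n -> T -> R) : Prop :=
  forall c : 'I_n -> R,
    ae_eq mu E (fun t => \sum_(i < n) c i * h i t) (fun=> 0) ->
    forall i, c i = 0.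

(* [u = \sum_i c_i phi_i] with convergence in the norm of L^2(E) *)
Definition L2_sum E (phi : nat -> T -> R) (c : nat -> R) u : Prop :=
  norm2 E (fun t => u t - \sum_(i < N) c i * phi i t) @[N --> \oo] --> (0 : R).

(* Riesz basis of the subspace V of L^2(E): a total sequence with two-sided
   l^2 bounds.  An orthonormal basis is the case a = b = 1.  Expansions have
   exactly the l^2 sequences as coefficients for such bases, which fails for
   general Schauder bases (rescale the vectors of an orthonormal one). *)
Definition riesz_basis E (V : set (T -> R)) (phi : nat -> T -> R) : Prop :=
  [/\ forall i, V (phi i),
      forall u, V u -> forall e : R, 0 < e -> exists N (c : nat -> R),
        norm2 E (fun t => u t - \sum_(i < N) c i * phi i t) < e
    & exists a b : R, [/\ 0 < a, 0 < b & forall N (c : nat -> R),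
        a * \sum_(i < N) c i ^+ 2
          <= norm2 E (fun t => \sum_(i < N) c i * phi i t) ^+ 2
          <= b * \sum_(i < N) c i ^+ 2]].

Definition kernel n (g h : 'I_n -> T -> R) (x t : T) : R :=
  \sum_(i < n) g i x * h i t.

Definition fredholm E n (g h : 'I_n -> T -> R) u (x : T) : R :=
  \int[mu]_(t in E) (kernel g h x t * u t).

(* In what follows, L : L^2(E) -> L^2(D) is given on representatives. *)
Definition solutions D E (L : (T -> R) -> T -> R) f : set (T -> R) :=
  [set u | L2 E u /\ ae_eq mu D (L u) f].

Definition null_space D E (L : (T -> R) -> T -> R) : set (T -> R) :=
  solutions D E L (fun=> 0).

Definition least_squares_solutions D E (L : (T -> R) -> T -> R) f :
    set (T -> R) :=
  [set u | L2 E u /\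
    norm2 D (L u \- f) = inf [set norm2 D (L v \- f) | v in L2 E]].

Definition min_norm_solution D E (L : (T -> R) -> T -> R) f u : Prop :=
  least_squares_solutions D E L f u /\
  norm2 E u = inf [set norm2 E v | v in least_squares_solutions D E L f].

Definition vecfun n (h : 'I_n -> T -> R) (t : T) : 'cV[R]_n := \col_i h i t.

(* [H = inner_mx E h h] and [A = inner_mx E h g] *)
Definition inner_mx E n (h g : 'I_n -> T -> R) : 'M[R]_n :=
  \matrix_(i, j) \int[mu]_(t in E) (h i t * g j t).

Definition inner_col E n f (h : 'I_n -> T -> R) : 'cV[R]_n :=
  \col_k \int[mu]_(t in E) (f t * h k t).

End L2.

Definition l2seq (R : realType) : set (nat -> R) :=
  [set c | (\sum_(i <oo) (c i ^+ 2)%:E < +oo)%E].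

(* Main.v *)
Require Import Defs.
From mathcomp Require Import all_boot all_order all_algebra.
From mathcomp Require Import all_classical all_reals all_analysis.
From mathcomp Require Import measurable_realfun lra ring.
Set Implicit Arguments.
Unset Strict Implicit.
Unset Printing Implicit Defensive.
Import Order.TTheory GRing.Theory Num.Theory.
Import numFieldNormedType.Exports.
Local Open Scope classical_set_scope.
Local Open Scope ring_scope.

(** An operator with kernel [\sum_i g_i(x) h_i(t)] acts by
    [L u = \sum_i (h_i, u) g_i], where [( , )] is the inner product of [L^2(E)].
    If [f = \sum_i w_i g_i] with [w = A^-1 F], the independence of the [g_i]
    makes [L u = f] equivalent to the constraints [(h_i, u) = w_i]
    ([solutions_fredholmP]); in particular the null space of [L] is the
    orthogonal complement of the [h_i].

    The Gram matrix [H] of the [h_i] is invertible ([gram_unitmx]), so exactly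
    one combination of the [h_i] meets the constraints: [udag], with
    coefficients [H^-1 w].  It solves the equation, so the least-squares
    solutions are the solutions ([least_squares_consistent]), and these form the
    coset of the null space through [udag].  Being a combination of the [h_i],
    [udag] is orthogonal to the null space, hence by Pythagoras it is the unique
    solution of least norm ([orthogonal_min_norm]); its squared norm is
    [\sum_i (H^-1 w)_i (h_i, udag) = w^T H^-1 w].

    It remains to see that the sums [\sum_i c_i phi_i] with [c] in [l^2] are
    exactly the elements of the null space.  For a Riesz basis, such sums exist
    because [L^2(E)] is complete ([L2_complete], [riesz_sum_cvg]); they lie in
    the null space because [( . , h_j)] is continuous ([L2_sum_orthogonal]); and
    every element of the null space is such a sum because the coefficients of
    its approximations form a Cauchy sequence in [l^2] ([riesz_expansion]). *)

(** * Square-integrable functions *)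

Section SquareIntegrable.
Context (disp : measure_display) (T : measurableType disp) (R : realType).
Variables (mu : {measure set T -> \bar R}) (E : set T).
Hypothesis mE : measurable E.
Implicit Types u v w : T -> R.

(** Reduces the definition, which speaks of extensions by zero and of real
    powers, to measurability and integrability of
    the square on [E]; all later closure properties are checked in this form. *)
Lemma L2P u : L2 mu E u <->
  measurable_fun E u /\ mu.-integrable E (EFin \o (fun t => u t ^+ 2)).
Proof.
have sqrE : EFin \o (fun t => (u \_ E) t ^+ 2) =
    (EFin \o (fun t => u t ^+ 2)) \_ E.
  apply/funext => t; rewrite /= !patchE.
  by case: ifP => //= _; rewrite expr0n.
split=> [u2|[mu_ iu]].
- move: (u2) => /Lfun2_integrable_sqr; rewrite sqrE => iu.
  split; last exact/integrable_mkcond.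
  apply/(measurable_restrictT _ mE).
  by move: u2; rewrite /L2 /= inE => /andP[]; rewrite inE.
- apply/andP; split; rewrite inE /=; first exact/(measurable_restrictT _ mE).
  rewrite /finite_norm unlock poweR_lty//.
  move/integrable_mkcond : iu => /(_ mE) /integrableP[_].
  apply: le_lt_trans; rewrite -sqrE le_eqVlt; apply/orP; left; apply/eqP.
  apply: eq_integral => t _ /=.
  by rewrite powR_mulrn ?normr_ge0 // normrX.
Qed.

Definition ip u v : R := \int[mu]_(t in E) (u t * v t).

Lemma ip_ge0 u : 0 <= ip u u.
Proof. by apply: Rintegral_ge0 => t _; rewrite -expr2 sqr_ge0. Qed.

(** When the integral of the square is infinite, both sides are 0 because
    [fine] sends infinity to 0; otherwise this is the definition of the norm. *)
Lemma norm2E u : norm2 mu E u = Num.sqrt (ip u u).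
Proof.
rewrite /norm2 unlock fine_poweR -powR12_sqrt ?ip_ge0//.
congr (fine _ `^ _); rewrite [RHS]integral_mkcond.
apply: eq_integral => t _ /=.
rewrite !patchE powR_mulrn ?normr_ge0// real_normK ?num_real//.
by case: ifP => _; rewrite ?expr2 ?mulr0.
Qed.

Lemma norm2_ge0 u : 0 <= norm2 mu E u.
Proof. by rewrite norm2E sqrtr_ge0. Qed.

Lemma norm2_sqr u : norm2 mu E u ^+ 2 = ip u u.
Proof. by rewrite norm2E sqr_sqrtr// ip_ge0. Qed.

Lemma L2_measurable u : L2 mu E u -> measurable_fun E u.
Proof. by case/L2P. Qed.

Lemma integrable_mul u v : L2 mu E u -> L2 mu E v ->
  mu.-integrable E (EFin \o (fun t => u t * v t)).
Proof.
move=> /L2P[mu_ iu] /L2P[mv iv].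
apply: (le_integrable mE _ _ (integrableD mE iu iv)).
  by apply/measurable_EFinP; exact: measurable_funM.
move=> t _ /=; rewrite lee_fin (ger0_norm (addr_ge0 _ _)) ?sqr_ge0//.
by rewrite ler_norml; apply/andP; split; nra.
Qed.

Lemma L2_integrable_sqr u : measurable_fun E u ->
  (\int[mu]_(t in E) (u t ^+ 2)%:E < +oo)%E -> L2 mu E u.
Proof.
move=> mu_ iu; apply/L2P; split=> //; apply/integrableP; split.
  by apply/measurable_EFinP; exact: measurable_funX.
apply: le_lt_trans iu; rewrite le_eqVlt; apply/orP; left; apply/eqP.
by apply: eq_integral => t _ /=; rewrite ger0_norm ?sqr_ge0.
Qed.

Lemma L2D u v : L2 mu E u -> L2 mu E v -> L2 mu E (fun t => u t + v t).
Proof.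
move=> Lu Lv; have [[mu_ iu] [mv iv]] := ((L2P u).1 Lu, (L2P v).1 Lv).
apply/L2P; split; first exact: measurable_funD.
apply: (@eq_integrable _ _ _ mu E mE (fun t =>
  ((u t ^+ 2)%:E + (v t ^+ 2)%:E) + 2%:E * (u t * v t)%:E)%E).
  by move=> t _ /=; rewrite -EFinM -!EFinD; congr (_%:E); ring.
by apply: integrableD => //; [exact: integrableD|
  apply: integrableZl => //; exact: integrable_mul].
Qed.

Lemma L2Z (c : R) u : L2 mu E u -> L2 mu E (fun t => c * u t).
Proof.
move=> /L2P[mu_ iu]; apply/L2P; split; first exact: measurable_funM.
apply: (@eq_integrable _ _ _ mu E mE (fun t => (c ^+ 2)%:E * (u t ^+ 2)%:E)%E).
  by move=> t _ /=; rewrite -EFinM exprMn.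
exact: integrableZl.
Qed.

Lemma L2_0 : L2 mu E (fun=> 0).
Proof.
by apply: L2_integrable_sqr => //; rewrite expr0n/= integral0.
Qed.

Lemma L2B u v : L2 mu E u -> L2 mu E v -> L2 mu E (fun t => u t - v t).
Proof.
move=> Lu /(@L2Z (-1)) /(L2D Lu); congr L2.
by apply/funext => t; rewrite mulN1r.
Qed.

Lemma L2_linear_combination n (c : 'I_n -> R) (w : 'I_n -> T -> R) :
  (forall i, L2 mu E (w i)) -> L2 mu E (fun t => \sum_i c i * w i t).
Proof.
move=> Lw; elim: n c w Lw => [|n IH] c w Lw.
  by under eq_fun do rewrite big_ord0; exact: L2_0.
under eq_fun do rewrite big_ord_recl.
by apply: L2D; [exact: L2Z|exact: IH].
Qed.

Lemma ipC u v : ip u v = ip v u.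
Proof. by apply: eq_Rintegral => t _; rewrite mulrC. Qed.

Lemma ipDl u v w : L2 mu E u -> L2 mu E v -> L2 mu E w ->
  ip (fun t => u t + v t) w = ip u w + ip v w.
Proof.
move=> Lu Lv Lw; rewrite -RintegralD//; last 2 first.
- exact: integrable_mul.
- exact: integrable_mul.
by apply: eq_Rintegral => t _; rewrite mulrDl.
Qed.

Lemma ipZl (c : R) u w : L2 mu E u -> L2 mu E w ->
  ip (fun t => c * u t) w = c * ip u w.
Proof.
move=> Lu Lw; rewrite -RintegralZl//; last exact: integrable_mul.
by apply: eq_Rintegral => t _; rewrite mulrA.
Qed.

Lemma ipBl u v w : L2 mu E u -> L2 mu E v -> L2 mu E w ->
  ip (fun t => u t - v t) w = ip u w - ip v w.
Proof.
move=> Lu Lv Lw; rewrite -RintegralB//; last 2 first.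
- exact: integrable_mul.
- exact: integrable_mul.
by apply: eq_Rintegral => t _; rewrite mulrBl.
Qed.

Lemma ip_suml n (c : 'I_n -> R) (v : 'I_n -> T -> R) w :
  (forall i, L2 mu E (v i)) -> L2 mu E w ->
  ip (fun t => \sum_i c i * v i t) w = \sum_i c i * ip (v i) w.
Proof.
move=> Lv Lw; elim: n c v Lv => [|n IH] c v Lv.
  rewrite big_ord0 -[RHS](mul0r (ip (fun=> 0) w)) -ipZl//; last exact: L2_0.
  by apply: eq_Rintegral => t _; rewrite big_ord0 mulr0.
rewrite big_ord_recl -ipZl// -IH// -ipDl//; [|exact: L2Z|exact: L2_linear_combination].
by apply: eq_Rintegral => t _; rewrite big_ord_recl.
Qed.

Lemma ip_sumr n (c : 'I_n -> R) (v : 'I_n -> T -> R) w :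
  (forall i, L2 mu E (v i)) -> L2 mu E w ->
  ip w (fun t => \sum_i c i * v i t) = \sum_i c i * ip w (v i).
Proof.
move=> Lv Lw; rewrite ipC ip_suml//.
by apply: eq_bigr => i _; rewrite ipC.
Qed.

Lemma norm2_sqrD u v (x y : R) : L2 mu E u -> L2 mu E v ->
  norm2 mu E (fun t => x * u t + y * v t) ^+ 2 =
  x ^+ 2 * norm2 mu E u ^+ 2 + 2 * x * y * ip u v
    + y ^+ 2 * norm2 mu E v ^+ 2.
Proof.
move=> Lu Lv; have [Lx Ly] := (L2Z x Lu, L2Z y Lv).
have Lxy := L2D Lx Ly.
rewrite !norm2_sqr ipDl// !ipZl// !(ipC _ (fun t => _ + _)).
by rewrite !ipDl// !ipZl// (ipC v u); ring.
Qed.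

(** The quadratic form [x^2 (u,u) + 2xy (u,v) + y^2 (v,v)] is a squared norm,
    hence nonnegative, and the bound says that its discriminant is nonpositive.
    *)
Lemma cauchy_schwarz u v : L2 mu E u -> L2 mu E v ->
  `|ip u v| <= norm2 mu E u * norm2 mu E v.
Proof.
move=> Lu Lv.
have [u0 v0] := (norm2_ge0 u, norm2_ge0 v).
rewrite -[leRHS]ger0_norm ?mulr_ge0// -[leLHS]sqrtr_sqr -[leRHS]sqrtr_sqr.
apply: ler_wsqrtr; rewrite exprMn !norm2_sqr.
have P x y : 0 <= x ^+ 2 * ip u u + 2 * x * y * ip u v + y ^+ 2 * ip v v.
  by rewrite -!norm2_sqr -norm2_sqrD// sqr_ge0.
have [c0|c0] := eqVneq (ip v v) 0.
  have [->|b0] := eqVneq (ip u v) 0; first by rewrite expr0n/= c0 mulr0.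
  (* At [x = 1] the form is affine in [y]; this [y] makes it negative. *)
  have := P 1 (- (ip u u + 1) / ip u v).
  rewrite c0 mulr0 addr0 expr1n mul1r mulr1 -mulrA divfK//.
  have := ip_ge0 u; lra.
have cp : 0 < ip v v by rewrite lt0r c0 ip_ge0.
(* The minimizing direction: there the form is [(v,v)] times the gap. *)
have Pcb := P (ip v v) (- ip u v).
rewrite -subr_ge0 -(pmulr_rge0 _ cp); apply: (le_trans Pcb).
by rewrite le_eqVlt; apply/orP; left; apply/eqP; ring.
Qed.

Lemma norm2D u v : L2 mu E u -> L2 mu E v ->
  norm2 mu E (fun t => u t + v t) <= norm2 mu E u + norm2 mu E v.
Proof.
move=> Lu Lv; have [u0 v0] := (norm2_ge0 u, norm2_ge0 v).
rewrite -(@ler_pXn2r _ 2)// ?nnegrE ?addr_ge0 ?norm2_ge0//.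
have := norm2_sqrD 1 1 Lu Lv; under eq_fun do rewrite !mul1r.
have := le_trans (ler_norm _) (cauchy_schwarz Lu Lv).
by nra.
Qed.

Lemma norm2_dist u v w : L2 mu E u -> L2 mu E v -> L2 mu E w ->
  norm2 mu E (fun t => u t - w t) <=
  norm2 mu E (fun t => u t - v t) + norm2 mu E (fun t => v t - w t).
Proof.
move=> Lu Lv Lw; have := norm2D (L2B Lu Lv) (L2B Lv Lw).
by under eq_fun do rewrite addrA subrK.
Qed.

Lemma norm2_distC u v :
  norm2 mu E (fun t => u t - v t) = norm2 mu E (fun t => v t - u t).
Proof.
rewrite !norm2E; congr Num.sqrt; apply: eq_Rintegral => t _; ring.
Qed.

Lemma norm2_eq0 u : L2 mu E u -> norm2 mu E u = 0 -> ae_eq mu E u (fun=> 0).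
Proof.
move=> Lu u0; have [mu_ iu] := (L2P u).1 Lu.
have {}u0 : ip u u = 0 by rewrite -norm2_sqr u0 expr0n.
have : (\int[mu]_(t in E) `|(u t ^+ 2)%:E| = 0)%E.
  have iu0 := integrable_fin_num mE iu.
  under eq_integral do rewrite gee0_abs ?lee_fin ?sqr_ge0//.
  by rewrite -(fineK iu0); congr (_%:E).
move/(ae_eq_integral_abs mu mE) => /(_ _)[|N [mN N0 sN]].
  by case/integrableP : iu.
exists N; split=> //; apply: subset_trans sN; apply: subsetC => t h Et.
by have /eqP := h Et; rewrite eqe sqrf_eq0 => /eqP.
Qed.

Lemma ae_eq_ip u v w : measurable_fun E u -> measurable_fun E v ->
  measurable_fun E w -> ae_eq mu E u v -> ip u w = ip v w.
Proof.
move=> mu_ mv mw uv; congr fine; apply: ae_eq_integral => //.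
- by apply/measurable_EFinP; exact: measurable_funM.
- by apply/measurable_EFinP; exact: measurable_funM.
by apply: filterS uv => t h Et; rewrite h.
Qed.

Lemma ae_eq_norm2 u v : measurable_fun E u -> measurable_fun E v ->
  ae_eq mu E u v -> norm2 mu E u = norm2 mu E v.
Proof.
move=> mu_ mv uv; rewrite !norm2E (ae_eq_ip mu_ mv mu_ uv) ipC.
by rewrite (ae_eq_ip mu_ mv mv uv).
Qed.

Lemma norm2_0 : norm2 mu E (fun=> 0) = 0.
Proof.
rewrite norm2E /ip; under eq_Rintegral do rewrite mul0r.
by rewrite Rintegral_cst// mul0r sqrtr0.
Qed.

End SquareIntegrable.

(** * Completeness *)

Lemma cauchy_seq_cvg (R : realType) (x : nat -> R) :
  (forall e : R, 0 < e -> exists N, forall m n,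
     (N <= m)%N -> (N <= n)%N -> `|x m - x n| <= e) ->
  cvgn x.
Proof.
move=> cx; apply/cauchy_cvgP/cauchy_exP => e e0.
have [N xN] := cx (e / 2) (divr_gt0 e0 (ltr0n _ 2)).
exists (x N), N => // n /= Nn; rewrite /ball /= distrC.
by rewrite (le_lt_trans (xN n N Nn (leqnn N)))// gtr_pMr// invf_lt1// ltr1n.
Qed.

Lemma half_exp_small (R : realType) (c e : R) : 0 < e ->
  exists k, c * 2^-1 ^+ k <= e.
Proof.
move=> e0; have h : `|2^-1 : R| < 1.
  by rewrite ger0_norm ?invr_ge0// invf_lt1// ltr1n.
have /cvgrPdist_le/(_ _ e0)[k _ /(_ k (leqnn k))] := cvg_geometric c h.
by rewrite /= sub0r normrN => /(le_trans (ler_norm _)); exists k.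
Qed.

Lemma nneseries_leP (R : realType) (a : nat -> R) (M : R) :
  (forall i, 0 <= a i) ->
  (\sum_(i <oo) (a i)%:E <= M%:E)%E <-> forall n, \sum_(i < n) a i <= M.
Proof.
move=> a0; split=> [aM n|aM].
- rewrite -lee_fin; apply: le_trans aM.
  rewrite -(big_mkord xpredT) -sumEFin; apply: nneseries_lim_ge => i _ _.
  by rewrite lee_fin.
- apply: lime_le; first by apply: is_cvg_nneseries => i _ _; rewrite lee_fin.
  by apply: nearW => n; rewrite sumEFin lee_fin big_mkord.
Qed.

Section Completeness.
Context (disp : measure_display) (T : measurableType disp) (R : realType).
Variables (mu : {measure set T -> \bar R}) (E : set T).
Hypothesis mE : measurable E.
Variable S : nat -> T -> R.
Hypothesis LS : forall n, L2 mu E (S n).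

(** Riesz--Fischer for a sequence whose increments [v_k] decay geometrically.
    The weighted square function [W = \sum_k 4^k v_k^2] has a finite integral by
    monotone convergence, so it is finite almost everywhere, and where it is
    finite [|v_k| <= sqrt(W) 2^-k].  Hence [S_k] converges pointwise there, with
    [|S_k - u|^2 <= 4 W 4^-k]; integrating this bound gives both [u] in
    [L^2(E)] and the rate of convergence in norm. *)
Lemma L2_complete_fast :
  (forall k, norm2 mu E (fun t => S k.+1 t - S k t) <= 4^-1 ^+ k) ->
  exists u (C : R), [/\ L2 mu E u &
    forall k, norm2 mu E (fun t => S k t - u t) <= C * 2^-1 ^+ k].
Proof.
move=> fS; pose v k t := S k.+1 t - S k t.
have Lv k : L2 mu E (v k) by exact: L2B.
have mv k := L2_measurable mE (Lv k).
pose w k t : R := 4 ^+ k * v k t ^+ 2.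
have w0 k t : 0 <= w k t by rewrite mulr_ge0 ?sqr_ge0 ?exprn_ge0.
pose W t := (\sum_(k <oo) (w k t)%:E)%E.
have W0 t : (0 <= W t)%E by apply: nneseries_ge0 => k _ _; rewrite lee_fin.
have mw k : measurable_fun E (fun t => (w k t)%:E).
  apply/measurable_EFinP; apply: measurable_funM => //.
  exact: measurable_funX.
have mW : measurable_fun E W.
  apply: (@ge0_emeasurable_sum _ _ _ _ (fun k t => (w k t)%:E) xpredT) => //.
  by move=> k t _ _; rewrite lee_fin.
have intW : (\int[mu]_(t in E) W t <= 2%:E)%E.
  rewrite integral_nneseries//; last by move=> k t _; rewrite lee_fin.
  have iw k : (\int[mu]_(t in E) (w k t)%:E =
      (4 ^+ k * norm2 mu E (v k) ^+ 2)%:E)%E.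
    rewrite norm2_sqr EFinM /ip /Rintegral fineK; last first.
      by apply: integrable_fin_num => //; exact: integrable_mul.
    rewrite -ge0_integralZl_EFin ?exprn_ge0//.
    - by move=> t _; rewrite lee_fin -expr2 sqr_ge0.
    - by apply/measurable_EFinP; exact: measurable_funM.
  under eq_eseriesr do rewrite iw.
  apply/nneseries_leP => [k|n]; first by rewrite mulr_ge0 ?sqr_ge0 ?exprn_ge0.
  have q0 k : 0 < 4^-1 ^+ k :> R by rewrite exprn_gt0.
  (* Subtracting a multiple of the last term lets the induction go through. *)
  apply: (@le_trans _ _ (2 - 2 * 4^-1 ^+ n)); last by have := q0 n; lra.
  elim: n => [|n IH]; first by rewrite big_ord0; lra.
  rewrite big_ord_recr /=.
  have : 4 ^+ n * norm2 mu E (v n) ^+ 2 <= 4^-1 ^+ n.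
    have -> : 4^-1 ^+ n = 4 ^+ n * (4^-1 ^+ n) ^+ 2 :> R.
      by rewrite expr2 mulrA -exprMn mulfV// expr1n mul1r.
    apply: ler_wpM2l; first exact: exprn_ge0.
    by rewrite ler_pXn2r ?nnegrE ?norm2_ge0 ?(ltW (q0 n))//; exact: fS.
  by have := q0 n; rewrite (exprS 4^-1); lra.
have iW : mu.-integrable E W.
  apply/integrableP; split=> //; apply: (@le_lt_trans _ _ 2%:E); last exact: ltry.
  by under eq_integral do rewrite gee0_abs//.
pose B := E `&` [set t | W t \is a fin_num].
have mB : measurable B by exact: emeasurable_fin_num.
have vW k t : B t -> `|v k t| <= Num.sqrt (fine (W t)) * 2^-1 ^+ k.
  move=> [_ Wt]; rewrite -sqrtr_sqr -[X in _ * X]ger0_norm ?exprn_ge0//.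
  rewrite -[X in _ * X]sqrtr_sqr -sqrtrM ?fine_ge0//; apply: ler_wsqrtr.
  have : w k t <= fine (W t).
    rewrite -lee_fin fineK//; apply: le_trans (nneseries_lim_ge k.+1 _).
      by rewrite big_nat_recr//= leeDr// sume_ge0// => i _; rewrite lee_fin.
    by move=> i _ _; rewrite lee_fin.
  have -> : (2^-1 ^+ k) ^+ 2 = (4 ^+ k)^-1 :> R.
    by rewrite exprAC -exprVn exprVn -natrX.
  by rewrite /w ler_pdivlMr ?exprn_gt0// mulrC.
have SB k l t : B t -> (k <= l)%N ->
    `|S l t - S k t| <= 2 * Num.sqrt (fine (W t)) * 2^-1 ^+ k.
  move=> Bt /subnK <-; move: (l - k)%N => {l} l.
  set s := Num.sqrt _.
  have s0 : 0 <= s by rewrite sqrtr_ge0.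
  have r0 n : 0 <= 2^-1 ^+ n :> R by rewrite exprn_ge0.
  apply: (@le_trans _ _ (2 * s * (2^-1 ^+ k - 2^-1 ^+ (l + k)))); last first.
    by have := mulr_ge0 s0 (r0 (l + k)%N); nra.
  elim: l => [|l IH]; first by rewrite add0n !subrr normr0 mulr0.
  have := vW (l + k)%N t Bt; rewrite /v -/s addSn => vl.
  have := le_trans (ler_distD (S (l + k)%N t) _ _) (lerD vl IH).
  by move/le_trans; apply; rewrite [in leRHS]exprS; nra.
(* Cutting off outside of [B] makes the sequence converge at every point, so
   that its pointwise limit is measurable. *)
pose U k := S k \_ B.
have mU k : measurable_fun setT (U k).
  apply/(measurable_restrictT _ mB).
  by apply: measurable_funS (L2_measurable mE (LS k)) => // t [].
have cU t : cvgn (U ^~ t).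
  apply: cauchy_seq_cvg => e e0.
  have [Bt|Bt] := pselect (B t); last first.
    exists 0%N => m n _ _; rewrite /U !patchE memNset// subrr normr0; exact: ltW.
  have [k kN] := half_exp_small (4 * Num.sqrt (fine (W t))) e0.
  exists k => m n km kn; rewrite /U !patchE mem_set//.
  apply: le_trans kN; apply: le_trans (ler_distD (S k t) _ _) _.
  rewrite (distrC (S k t)).
  by have := lerD (SB _ _ _ Bt km) (SB _ _ _ Bt kn); move/le_trans; apply; lra.
pose u t := limn (U ^~ t).
have mu_ : measurable_fun E u.
  apply: measurable_funTS; apply: (measurable_fun_cvg mU) => t _; exact: cU.
have uB k t : B t ->
    (S k t - u t) ^+ 2 <= 4 * (2^-1 ^+ k) ^+ 2 * fine (W t).
  move=> Bt.
  have : `|S k t - u t| <= 2 * Num.sqrt (fine (W t)) * 2^-1 ^+ k.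
    rewrite distrC.
    have : `|U n t - S k t| @[n --> \oo] --> `|u t - S k t|.
      by apply: cvg_norm; apply: cvgB; [exact: cU|exact: cvg_cst].
    move/cvgr_to_le; apply; exists k => // n /= kn.
    by rewrite /U patchE mem_set//; exact: SB.
  rewrite -(@ler_pXn2r _ 2)// ?nnegrE ?mulr_ge0 ?sqrtr_ge0 ?exprn_ge0//.
  rewrite real_normK ?num_real// !exprMn sqr_sqrtr ?fine_ge0//.
  by move/le_trans; apply; rewrite le_eqVlt; apply/orP; left; apply/eqP; ring.
have aeB : {ae mu, forall t, E t -> B t}.
  by apply: filterS (integrable_ae mE iW) => t h Et; split => //; exact: h.
have iu k : (\int[mu]_(t in E) ((S k t - u t) ^+ 2)%:E <=
    (8 * (2^-1 ^+ k) ^+ 2)%:E)%E.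
  apply: (@le_trans _ _ (\int[mu]_(t in E)
      ((4 * (2^-1 ^+ k) ^+ 2)%:E * W t))%E).
    apply: ae_ge0_le_integral => //.
    - by move=> t _; rewrite lee_fin sqr_ge0.
    - apply/measurable_EFinP; apply: measurable_funX; apply: measurable_funB => //.
      exact: (L2_measurable mE).
    - by move=> t _; rewrite mule_ge0// lee_fin mulr_ge0 ?sqr_ge0.
    - exact: measurable_funeM.
    apply: filterS aeB => t h Et; have Bt := h Et.
    by rewrite -(fineK Bt.2) -EFinM lee_fin; exact: uB.
  rewrite ge0_integralZl_EFin ?mulr_ge0 ?sqr_ge0//.
  apply: (@le_trans _ _ ((4 * (2^-1 ^+ k) ^+ 2)%:E * 2%:E)%E).
    by apply: lee_wpmul2l => //; rewrite lee_fin mulr_ge0 ?sqr_ge0.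
  by rewrite -EFinM lee_fin le_eqVlt; apply/orP; left; apply/eqP; ring.
have LSu k : L2 mu E (fun t => S k t - u t).
  apply: L2_integrable_sqr => //; last by apply: le_lt_trans (iu k) (ltry _).
  apply: measurable_funB => //; exact: (L2_measurable mE).
exists u, (Num.sqrt 8); split.
  have := L2B mE (LS 0%N) (LSu 0%N); congr L2.
  by apply/funext => t; rewrite subKr.
move=> k; rewrite norm2E -[X in _ * X]ger0_norm ?exprn_ge0//.
rewrite -[X in _ * X]sqrtr_sqr -sqrtrM//; apply: ler_wsqrtr.
rewrite -lee_fin /ip /Rintegral fineK; last first.
  by apply: integrable_fin_num => //; exact: integrable_mul.
by under eq_integral do rewrite -expr2; exact: iu.
Qed.

End Completeness.

(** * Series in a Riesz basis *)

Lemma sum_ord_tail (V : zmodType) (F : nat -> V) m n : (m <= n)%N ->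
  \sum_(i < n) (if (i < m)%N then 0 else F i) =
  \sum_(i < n) F i - \sum_(i < m) F i.
Proof.
move=> mn; rewrite (big_ord_widen n F mn) [X in _ - X]big_mkcond -sumrB.
by apply: eq_bigr => i _; case: ifP; rewrite ?subrr ?subr0.
Qed.

Lemma le_sum_ord (R : realType) (F : nat -> R) m n : (forall i, 0 <= F i) ->
  (m <= n)%N -> \sum_(i < m) F i <= \sum_(i < n) F i.
Proof.
move=> F0 mn; rewrite -subr_ge0 -sum_ord_tail//.
by apply: sumr_ge0 => i _; case: ifP.
Qed.

(** Bounded partial sums are easier to produce and to use than a finite
    extended-real series. *)
Lemma l2seqP (R : realType) (c : nat -> R) :
  l2seq c <-> exists M, forall n, \sum_(i < n) c i ^+ 2 <= M.
Proof.
have c0 i : 0 <= c i ^+ 2 by exact: sqr_ge0.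
split=> [cy|[M /(nneseries_leP _ c0) cM]]; last exact: le_lt_trans cM (ltry _).
have cf : (\sum_(i <oo) (c i ^+ 2)%:E \is a fin_num)%E.
  by rewrite ge0_fin_numE// nneseries_ge0// => i _ _; rewrite lee_fin.
by exists (fine (\sum_(i <oo) (c i ^+ 2)%:E)%E); 
  apply/(nneseries_leP _ c0); rewrite fineK.
Qed.

Section Series.
Context (disp : measure_display) (T : measurableType disp) (R : realType).
Variables (mu : {measure set T -> \bar R}) (E : set T).
Hypothesis mE : measurable E.

(** A Cauchy sequence has a subsequence with geometrically decaying increments;
    the limit of the subsequence is the limit of the sequence. *)
Lemma L2_complete (S : nat -> T -> R) : (forall n, L2 mu E (S n)) ->
  (forall e : R, 0 < e -> exists N, forall m n, (N <= m)%N -> (N <= n)%N ->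
     norm2 mu E (fun t => S m t - S n t) <= e) ->
  exists2 u, L2 mu E u & forall e : R, 0 < e -> exists N, forall n, (N <= n)%N ->
     norm2 mu E (fun t => u t - S n t) <= e.
Proof.
move=> LS cS.
have q0 k : 0 < 4^-1 ^+ k :> R by rewrite exprn_gt0.
have [N NS] := choice (fun k => cS _ (q0 k)).
(* Summing the thresholds makes the chosen indices nondecreasing. *)
pose p k := (\sum_(i < k.+1) N i)%N.
have Np k : (N k <= p k)%N by rewrite /p big_ord_recr /= leq_addl.
have pS k : (p k <= p k.+1)%N by rewrite [leqRHS]/p big_ord_recr leq_addr.
have [|u [C [Lu uC]]] := @L2_complete_fast _ _ _ mu E mE (S \o p) (fun k => LS (p k)).
  by move=> k; apply: NS; [exact: leq_trans (pS k)|exact: Np].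
exists u => // e e0.
have [k kC] := half_exp_small (1 + C) e0.
exists (p k) => n pn; apply: le_trans kC.
apply: le_trans (norm2_dist mE Lu (LS (p k)) (LS n)) _.
rewrite addrC mulrDl mul1r norm2_distC; apply: lerD; last first.
  by rewrite norm2_distC; exact: uC.
apply: (@le_trans _ _ (4^-1 ^+ k)); first by apply: NS; [exact: leq_trans pn|exact: Np].
by apply: lerXn2r; rewrite ?nnegrE ?invr_ge0// lef_pV2 ?posrE// ler_nat.
Qed.

Variable phi : nat -> T -> R.
Hypothesis Lphi : forall i, L2 mu E (phi i).
Implicit Types (c : nat -> R) (u : T -> R).

Lemma L2_sumP c u : L2_sum mu E phi c u <->
  forall e : R, 0 < e -> exists N, forall n, (N <= n)%N ->
    norm2 mu E (fun t => u t - \sum_(i < n) c i * phi i t) <= e.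
Proof.
split=> [/cvgrPdist_le cu e e0|cu].
  have [N _ uN] := cu e e0; exists N => n /uN /=.
  by rewrite sub0r normrN ger0_norm// norm2_ge0.
apply/cvgrPdist_le => e /cu[N uN]; exists N => // n /= /uN.
by rewrite sub0r normrN ger0_norm// norm2_ge0.
Qed.

(** By Cauchy--Schwarz the inner product with [w] is continuous, and it vanishes
    on all partial sums. *)
Lemma L2_sum_orthogonal c u w : L2 mu E u -> L2 mu E w ->
  (forall i, ip mu E (phi i) w = 0) -> L2_sum mu E phi c u -> ip mu E u w = 0.
Proof.
move=> Lu Lw pw /L2_sumP cu; apply/eqP; rewrite -normr_le0.
apply/ler_addgt0Pr => e e0; rewrite add0r.
have w1 : 0 < norm2 mu E w + 1 by rewrite ltr_wpDl ?norm2_ge0.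
have [N /(_ N (leqnn N))] := cu (e / (norm2 mu E w + 1)) (divr_gt0 e0 w1).
set s := fun t => \sum_(i < N) c i * phi i t.
have Ls : L2 mu E s by exact: L2_linear_combination.
rewrite ler_pdivlMr// => uw.
have -> : ip mu E u w = ip mu E (fun t => u t - s t) w.
  rewrite ipBl// (@ip_suml _ _ _ mu E mE N c phi)// big1 ?subr0// => i _.
  by rewrite pw mulr0.
apply: le_trans (cauchy_schwarz mE (L2B mE Lu Ls) Lw) (le_trans _ uw).
by rewrite ler_wpM2l ?norm2_ge0// lerDl.
Qed.

Variables a b : R.
Hypotheses (a0 : 0 < a) (b0 : 0 < b).
Hypothesis riesz : forall N c,
  a * \sum_(i < N) c i ^+ 2
    <= norm2 mu E (fun t => \sum_(i < N) c i * phi i t) ^+ 2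
    <= b * \sum_(i < N) c i ^+ 2.

(** The upper Riesz bound turns the Cauchy property of the partial sums of
    [\sum_i c_i^2] into that of the partial sums of [\sum_i c_i phi_i]. *)
Lemma riesz_sum_cvg c : l2seq c ->
  exists2 u, L2 mu E u & L2_sum mu E phi c u.
Proof.
move=> /l2seqP[M cM].
pose S n t := \sum_(i < n) c i * phi i t.
pose s n := \sum_(i < n) c i ^+ 2.
have LS n : L2 mu E (S n) by exact: L2_linear_combination.
have Ss m n : (m <= n)%N ->
    norm2 mu E (fun t => S n t - S m t) ^+ 2 <= b * (s n - s m).
  (* The increment is the combination whose first [m] coefficients vanish. *)
  move=> mn; have /andP[_] := riesz n (fun i => if (i < m)%N then 0 else c i).
  have -> : \sum_(i < n) (if (i < m)%N then 0 else c i) ^+ 2 = s n - s m.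
    rewrite -(sum_ord_tail (fun i => c i ^+ 2))//; apply: eq_bigr => i _.
    by case: ifP; rewrite ?expr0n.
  suff -> : (fun t => \sum_(i < n) (if (i < m)%N then 0 else c i) * phi i t) =
    (fun t => S n t - S m t) by [].
  apply/funext => t; rewrite -(sum_ord_tail (fun i => c i * phi i t))//.
  by apply: eq_bigr => i _; case: ifP; rewrite ?mul0r.
have cs : cvgn s.
  apply: nondecreasing_is_cvgn.
    by move=> m n; apply: (@le_sum_ord _ (fun i => c i ^+ 2)) => i; exact: sqr_ge0.
  by exists M => _ [n _ <-]; exact: cM.
have [|u Lu uS] := @L2_complete S LS; last by exists u => //; apply/L2_sumP.
move=> e e0.
have e2 : 0 < e ^+ 2 / (2 * b) by rewrite divr_gt0 ?exprn_gt0 ?mulr_gt0.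
have /cvgrPdist_le/(_ _ e2)[N _ sN] := cs.
have H m n : (N <= m)%N -> (m <= n)%N -> norm2 mu E (fun t => S n t - S m t) <= e.
  move=> Nm mn; rewrite -(@ler_pXn2r _ 2)// ?nnegrE ?norm2_ge0 ?(ltW e0)//.
  apply: le_trans (Ss _ _ mn) _; rewrite mulrC -ler_pdivlMr//.
  have := le_trans (ler_distD (limn s) (s n) (s m)) _.
  move=> /(_ (e ^+ 2 / b)) h; apply: le_trans (ler_norm _) (h _).
  have -> : e ^+ 2 / b = e ^+ 2 / (2 * b) + e ^+ 2 / (2 * b).
    by field; rewrite gt_eqF.
  by apply: lerD; [rewrite distrC|]; apply: sN => //=; exact: leq_trans mn.
exists N => m n Nm Nn; case/orP: (leq_total m n) => mn; last exact: H.
by rewrite norm2_distC; exact: H.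
Qed.

(** Take finite combinations approximating [u] within [2^-k], and let [d k] be
    their coefficients, padded with zeros.  Any two of them are close in norm,
    so by the lower Riesz bound the sequences [d k] are Cauchy in [l^2]; let [c]
    be their limit.  By the upper bound, long partial sums with coefficients [c]
    are as close to those with coefficients [d k] as [c] is to [d k] in [l^2],
    hence they approximate [u]. *)
Lemma riesz_expansion u : L2 mu E u ->
  (forall e : R, 0 < e -> exists N c,
     norm2 mu E (fun t => u t - \sum_(i < N) c i * phi i t) < e) ->
  exists2 c, l2seq c & L2_sum mu E phi c u.
Proof.
move=> Lu apx; pose S c n t := \sum_(i < n) c i * phi i t.
have LS c n : L2 mu E (S c n) by exact: L2_linear_combination.
pose r k : R := 2^-1 ^+ k.
have r0 k : 0 < r k by rewrite exprn_gt0.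
have rr0 k l : 0 <= r k + r l by rewrite addr_ge0 ?(ltW (r0 _)).
have rle k l : (k <= l)%N -> r l <= r k.
  by move=> kl; rewrite /r ler_wiXn2l// invf_le1// ler1n.
have /choice[f fP] : forall k, exists f : nat * (nat -> R),
    norm2 mu E (fun t => u t - S f.2 f.1 t) < r k.
  by move=> k; have [N [c Nc]] := apx _ (r0 k); exists (N, c).
pose N k := (f k).1.
pose d k i := if (i < N k)%N then (f k).2 i else 0.
have ud k M : (N k <= M)%N -> norm2 mu E (fun t => u t - S (d k) M t) <= r k.
  move=> NM; have := ltW (fP k); congr (norm2 mu E _ <= _).
  apply/funext => t; congr (_ - _).
  rewrite /S (big_ord_widen M (fun i => (f k).2 i * phi i t) NM) big_mkcond.
  by apply: eq_bigr => i _; rewrite /d; case: ifP; rewrite ?mul0r.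
have SB c c' M : norm2 mu E (S (fun i => c i - c' i) M) =
    norm2 mu E (fun t => S c M t - S c' M t).
  congr (norm2 mu E _); apply/funext => t; rewrite /S -sumrB.
  by apply: eq_bigr => i _; rewrite mulrBl.
have dd k l M : \sum_(i < M) (d k i - d l i) ^+ 2 <= (r k + r l) ^+ 2 / a.
  pose M' := maxn M (maxn (N k) (N l)).
  have MM : (M <= M')%N by exact: leq_maxl.
  have kM : (N k <= M')%N by exact: leq_trans (leq_maxl _ _) (leq_maxr _ _).
  have lM : (N l <= M')%N by exact: leq_trans (leq_maxr _ _) (leq_maxr _ _).
  apply: le_trans (@le_sum_ord _ (fun i => (d k i - d l i) ^+ 2) _ _ _ MM) _.
    by move=> i; exact: sqr_ge0.
  rewrite ler_pdivlMr// mulrC.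
  have /andP[/le_trans + _] := riesz M' (fun i => d k i - d l i); apply.
  rewrite -/(S _ _) SB ler_pXn2r ?nnegrE ?norm2_ge0 ?rr0//.
  apply: le_trans (norm2_dist mE (LS _ _) Lu (LS _ _)) _.
  by rewrite norm2_distC lerD ?ud.
have cd i : cvgn (d ^~ i).
  apply: cauchy_seq_cvg => e e0.
  have [K rK] := half_exp_small (2 * Num.sqrt a^-1) e0.
  exists K => k l Kk Kl; apply: le_trans rK.
  rewrite -sqrtr_sqr -/(r K).
  have -> : 2 * Num.sqrt a^-1 * r K = Num.sqrt ((r K + r K) ^+ 2 / a).
    rewrite sqrtrM ?sqr_ge0// sqrtr_sqr ger0_norm ?rr0//; ring.
  apply: ler_wsqrtr; apply: le_trans (_ : (r k + r l) ^+ 2 / a <= _).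
    apply: le_trans (dd k l i.+1).
    by rewrite big_ord_recr /= lerDr sumr_ge0// => j _; exact: sqr_ge0.
  rewrite ler_pM2r ?invr_gt0// ler_pXn2r ?nnegrE ?rr0//.
  by apply: lerD; exact: rle.
pose c i := limn (d ^~ i).
have cl l M : \sum_(i < M) (c i - d l i) ^+ 2 <= (r l + r l) ^+ 2 / a.
  have : \sum_(i < M) (d k i - d l i) ^+ 2 @[k --> \oo] -->
      \sum_(i < M) (c i - d l i) ^+ 2.
    apply: cvg_big => [|i _]; first exact: add_continuous.
    rewrite expr2; under eq_fun do rewrite expr2.
    by apply: cvgM; apply: cvgB; [exact: cd|exact: cvg_cst|exact: cd|exact: cvg_cst].
  move/cvgr_to_le; apply; exists l => // k /= lk; apply: le_trans (dd k l M) _.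
  rewrite ler_pM2r ?invr_gt0// ler_pXn2r ?nnegrE ?rr0//.
  by apply: lerD => //; exact: rle.
pose C := 1 + 2 * Num.sqrt (b / a).
have uc l M : (N l <= M)%N -> norm2 mu E (fun t => u t - S c M t) <= C * r l.
  move=> NM; apply: le_trans (norm2_dist mE Lu (LS (d l) M) (LS c M)) _.
  rewrite mulrDl mul1r; apply: lerD; first exact: ud.
  rewrite norm2_distC -SB.
  have -> : 2 * Num.sqrt (b / a) * r l = Num.sqrt (b * ((r l + r l) ^+ 2 / a)).
    rewrite (mulrCA b) [RHS]sqrtrM ?sqr_ge0// sqrtr_sqr ger0_norm ?rr0//; ring.
  rewrite -[leLHS]ger0_norm ?norm2_ge0// -sqrtr_sqr; apply: ler_wsqrtr.
  have /andP[_ /le_trans] := riesz M (fun i => c i - d l i); apply.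
  by rewrite ler_pM2l.
exists c; last first.
  apply/L2_sumP => e e0; have [l lC] := half_exp_small C e0.
  by exists (N l) => n Nn; apply: le_trans lC; exact: uc.
apply/l2seqP; exists ((norm2 mu E u + C) ^+ 2 / a) => M.
pose M' := maxn M (N 0%N).
apply: le_trans (@le_sum_ord _ (fun i => c i ^+ 2) _ M' _ _) _.
- by move=> i; exact: sqr_ge0.
- exact: leq_maxl.
rewrite ler_pdivlMr// mulrC.
have /andP[/le_trans + _] := riesz M' c; apply.
have uM := uc 0%N M' (leq_maxr _ _).
rewrite /r expr0 mulr1 in uM.
have C0 : 0 <= C by rewrite addr_ge0 ?mulr_ge0 ?sqrtr_ge0.
rewrite -/(S _ _) ler_pXn2r ?nnegrE ?norm2_ge0 ?addr_ge0 ?norm2_ge0//.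
have := norm2_dist mE (LS c M') Lu (L2_0 mu mE).
under eq_fun do rewrite subr0; under [X in _ + norm2 _ _ X]eq_fun do rewrite subr0.
rewrite norm2_distC addrC => /le_trans; apply.
by rewrite lerD2l.
Qed.

End Series.

(** * Degenerate kernels *)

Lemma inf_min (R : realType) (A : set R) (x : R) :
  A x -> lbound A x -> inf A = x.
Proof.
move=> Ax lx; apply/eqP; rewrite eq_le; apply/andP; split.
  by apply: ge_inf => //; exists x.
by apply: lb_le_inf => //; exists x.
Qed.

Section Fredholm.
Context (disp : measure_display) (T : measurableType disp) (R : realType).
Variables (mu : {measure set T -> \bar R}) (D E : set T).
Hypotheses (mD : measurable D) (mE : measurable E).

Lemma norm2_sub_eq0 (u v : T -> R) : L2 mu D u -> L2 mu D v ->
  norm2 mu D (u \- v) = 0 <-> ae_eq mu D u v.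
Proof.
move=> Lu Lv; split=> [uv0|uv].
  have := norm2_eq0 mD (L2B mD Lu Lv) uv0.
  by apply: filterS => t h Dt; apply/eqP; rewrite -subr_eq0; apply/eqP/h.
rewrite -(norm2_0 mu mD); apply: ae_eq_norm2 => //.
  exact: L2_measurable (L2B mD Lu Lv).
by apply: filterS uv => t h Dt; rewrite /= h// subrr.
Qed.

(** When the equation is solvable the least residual is 0, so the least-squares
    solutions are the solutions. *)
Lemma least_squares_consistent (L : (T -> R) -> T -> R) f u0 :
  (forall u, L2 mu E u -> L2 mu D (L u)) -> L2 mu D f ->
  solutions mu D E L f u0 ->
  least_squares_solutions mu D E L f = solutions mu D E L f.
Proof.
move=> LL Lf [Lu0 u0f].
have -> : least_squares_solutions mu D E L f =
    [set u | L2 mu E u /\ norm2 mu D (L u \- f) = 0].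
  rewrite /least_squares_solutions; suff -> : inf [set norm2 mu D (L v \- f) |
    v in L2 mu E] = 0 by [].
  apply: inf_min; last by move=> _ [v _ <-]; exact: norm2_ge0.
  by exists u0 => //; apply/norm2_sub_eq0 => //; exact: LL.
apply/seteqP; split=> u [Lu] uf; split=> //.
  by apply/norm2_sub_eq0 => //; exact: LL.
by apply/norm2_sub_eq0 => //; exact: LL.
Qed.

Lemma pythagoras (u v : T -> R) : L2 mu E u -> L2 mu E v ->
  ip mu E u (v \- u) = 0 ->
  norm2 mu E v ^+ 2 = norm2 mu E u ^+ 2 + norm2 mu E (v \- u) ^+ 2.
Proof.
move=> Lu Lv uv; have := norm2_sqrD mE 1 1 Lu (L2B mE Lv Lu).
under eq_fun do rewrite !mul1r addrC subrK.
by move=> ->; rewrite uv !expr1n mulr0 !mul1r addr0.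
Qed.

(** By Pythagoras, an element [u0] of [S] that is orthogonal to all differences
    [u - u0] has the least norm in [S], and any other minimizer is at distance 0
    from it. *)
Lemma orthogonal_min_norm (S : set (T -> R)) u0 :
  (forall u, S u -> L2 mu E u) -> S u0 ->
  (forall u, S u -> ip mu E u0 (u \- u0) = 0) ->
  norm2 mu E u0 = inf [set norm2 mu E v | v in S] /\
  forall u, S u -> norm2 mu E u = inf [set norm2 mu E v | v in S] ->
    ae_eq mu E u u0.
Proof.
move=> SL Su0 orth.
have infS : inf [set norm2 mu E v | v in S] = norm2 mu E u0.
  apply: inf_min; first by exists u0.
  move=> _ [v Sv <-]; rewrite -(@ler_pXn2r _ 2)// ?nnegrE ?norm2_ge0//.
  by rewrite (pythagoras (SL _ Su0) (SL _ Sv) (orth _ Sv)) lerDl sqr_ge0.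
rewrite infS; split=> // u Su uu0.
have Lu := SL _ Su; have Lu0 := SL _ Su0.
have /eqP := pythagoras Lu0 Lu (orth _ Su).
rewrite uu0 -subr_eq0 opprD addrA subrr sub0r oppr_eq0 sqrf_eq0 => /eqP uv0.
have := norm2_eq0 mE (L2B mE Lu Lu0) uv0.
by apply: filterS => t h Et; apply/eqP; rewrite -subr_eq0; apply/eqP/h.
Qed.

Variable n : nat.
Implicit Types (g h : 'I_n -> T -> R).

Lemma ip_inner_mx h (y : 'cV[R]_n) j : (forall i, L2 mu E (h i)) ->
  ip mu E (h j) (fun t => \sum_i y i ord0 * h i t) =
  (inner_mx mu E h h *m y) j ord0.
Proof.
by move=> Lh; rewrite ip_sumr// mxE; apply: eq_bigr => i _; rewrite mxE mulrC.
Qed.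

Lemma inner_mx_sym h : (inner_mx mu E h h)^T = inner_mx mu E h h.
Proof. by apply/matrixP => i j; rewrite !mxE; exact: ipC. Qed.

(** A vector [v] in the kernel of the Gram matrix gives a combination
    [u = \sum_i v_i h_i] orthogonal to every [h_j], hence to itself. *)
Lemma gram_unitmx h : (forall i, L2 mu E (h i)) -> lin_indep mu E h ->
  inner_mx mu E h h \in unitmx.
Proof.
move=> Lh hfree; rewrite -row_free_unit; apply: inj_row_free => v vH.
have Hv : inner_mx mu E h h *m v^T = 0.
  by rewrite -(inner_mx_sym h) -trmx_mul vH trmx0.
pose u t := \sum_i v^T i ord0 * h i t.
have Lu : L2 mu E u by exact: L2_linear_combination.
have uu : ip mu E u u = 0.
  by rewrite ip_suml// big1// => i _; rewrite ip_inner_mx// Hv [X in _ * X]mxE mulr0.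
have u0 : ae_eq mu E u (fun=> 0).
  by apply: norm2_eq0 => //; rewrite norm2E uu sqrtr0.
by apply/rowP => i; have := hfree _ u0 i; rewrite !mxE.
Qed.

Lemma fredholmE g h u x : (forall i, L2 mu E (h i)) -> L2 mu E u ->
  fredholm mu E g h u x = \sum_i ip mu E (h i) u * g i x.
Proof.
move=> Lh Lu; have := ip_suml mE (g^~ x) Lh Lu.
by rewrite /fredholm /ip => ->; apply: eq_bigr => i _; rewrite mulrC.
Qed.

(** Since [L u = \sum_i (h_i, u) g_i] and the [g_i] are independent, comparing
    coefficients turns the integral equation into [n] linear constraints on
    [u]. *)
Lemma solutions_fredholmP g h (w : 'I_n -> R) f u :
  (forall i, L2 mu E (h i)) -> lin_indep mu D g ->
  ae_eq mu D f (fun x => \sum_i w i * g i x) -> L2 mu E u ->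
  solutions mu D E (fredholm mu E g h) f u <->
  forall i, ip mu E (h i) u = w i.
Proof.
move=> Lh gfree fw Lu; have LE x := fredholmE g x Lh Lu.
split=> [[_ uf] i|uw].
  apply/eqP; rewrite -subr_eq0; apply/eqP; move: i; apply: gfree.
  apply: filterS2 uf fw => x /[swap] fx /[swap] Dx /(_ Dx).
  rewrite LE fx// => ux; under eq_bigr do rewrite mulrBl.
  by rewrite sumrB ux subrr.
split=> //; apply: filterS fw => x fx Dx; rewrite fx// LE.
by apply: eq_bigr => i _; rewrite uw.
Qed.

Lemma null_space_fredholmP g h u :
  (forall i, L2 mu E (h i)) -> lin_indep mu D g -> L2 mu E u ->
  null_space mu D E (fredholm mu E g h) u <->
  forall i, ip mu E (h i) u = 0.
Proof.
move=> Lh gfree; apply: solutions_fredholmP => //.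
by apply: aeW => x _; rewrite big1// => i _; rewrite mul0r.
Qed.

(** The result over an arbitrary measure space.  The right-hand side enters only
    through its coordinates [w] in the [g_i]. *)
Theorem degenerate_fredholm g h (phi : nat -> T -> R) f (w : 'cV[R]_n) :
  let L := fredholm mu E g h in
  let H := inner_mx mu E h h in
  let udag := fun t => \sum_i (invmx H *m w) i ord0 * h i t in
  (forall i, L2 mu D (g i)) -> lin_indep mu D g ->
  (forall i, L2 mu E (h i)) -> lin_indep mu E h ->
  riesz_basis mu E (null_space mu D E L) phi ->
  L2 mu D f -> ae_eq mu D f (fun x => \sum_i w i ord0 * g i x) ->
  [/\ H \in unitmx,
      min_norm_solution mu D E L f udag /\
      (forall u, min_norm_solution mu D E L f u -> ae_eq mu E u udag),
      norm2 mu E udag ^+ 2 = (w^T *m invmx H *m w) ord0 ord0,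
      (forall u, L2 mu E u ->
         (solutions mu D E L f u <->
          exists2 c, @l2seq R c & L2_sum mu E phi c (u \- udag)))
    & forall c, @l2seq R c ->
         exists2 u, L2 mu E u & L2_sum mu E phi c (u \- udag)].
Proof.
move=> L H udag Lg gfree Lh hfree [phiN phi_total [a [b [a0 b0 phi_bounds]]]] Lf fw.
have Hu : H \in unitmx by exact: gram_unitmx.
have Lud : L2 mu E udag by exact: L2_linear_combination.
have hud i : ip mu E (h i) udag = w i ord0.
  by rewrite ip_inner_mx// mulKVmx.
have ud_ip v : L2 mu E v -> ip mu E udag v =
    \sum_i (invmx H *m w) i ord0 * ip mu E (h i) v.
  by move=> Lv; rewrite ip_suml.
have solP u : L2 mu E u ->
    solutions mu D E L f u <-> forall i, ip mu E (h i) u = w i ord0.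
  by move=> Lu; exact: solutions_fredholmP.
have sol_ud : solutions mu D E L f udag by apply/solP.
have nullP u : L2 mu E u ->
    solutions mu D E L f u <-> null_space mu D E L (u \- udag).
  move=> Lu; have Lv := L2B mE Lu Lud.
  have hB i : ip mu E (h i) (u \- udag) = ip mu E (h i) u - w i ord0.
    by rewrite ipC (ipBl mE Lu Lud (Lh i)) -hud !(ipC _ _ (h i)).
  rewrite solP// null_space_fredholmP//.
  split=> hu i; first by rewrite hB hu subrr.
  by apply/eqP; rewrite -subr_eq0 -hB hu.
have LL u : L2 mu E u -> L2 mu D (L u).
  move=> Lu; rewrite (_ : L u = fun x => \sum_i ip mu E (h i) u * g i x).
    exact: L2_linear_combination.
  by apply/funext => x; exact: fredholmE.
have lsq := least_squares_consistent LL Lf sol_ud.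
have orth u : solutions mu D E L f u -> ip mu E udag (u \- udag) = 0.
  move=> solu; have Lu := solu.1; have Lv := L2B mE Lu Lud.
  rewrite (ud_ip _ Lv) big1// => i _.
  have /(_ i) -> := (null_space_fredholmP Lh gfree Lv).1 ((nullP u Lu).1 solu).
  by rewrite mulr0.
have [ud_min ud_uniq] := orthogonal_min_norm (S := solutions mu D E L f)
  (fun u => @proj1 _ _) sol_ud orth.
have Lphi i : L2 mu E (phi i) by case: (phiN i).
split=> //.
- split=> [|u]; first by split; rewrite lsq.
  by move=> []; rewrite lsq; exact: ud_uniq.
- rewrite norm2_sqr ud_ip// -mulmxA [RHS]mxE.
  by apply: eq_bigr => i _; rewrite hud mulrC [in RHS]mxE.
- move=> u Lu; have Lv := L2B mE Lu Lud; rewrite nullP//; split=> [vN|[c _ cv]].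
    exact: (riesz_expansion mE Lphi a0 b0 phi_bounds Lv (phi_total _ vN)).
  apply/null_space_fredholmP => // i; rewrite ipC.
  apply: (L2_sum_orthogonal mE Lphi Lv (Lh i) _ cv) => j; rewrite ipC.
  exact: (null_space_fredholmP Lh gfree (Lphi j)).1.
- move=> c c2; have [v Lv cv] := riesz_sum_cvg mE Lphi b0 phi_bounds c2.
  exists (fun t => v t + udag t); first exact: L2D.
  move: cv; congr (L2_sum mu E phi c _).
  by apply/funext => t; rewrite /= addrK.
Qed.
End Fredholm.

Theorem theorem1 (R : realType) (d n : nat) (D E : set (euclid R d))
    (mD : measurable D) (mE : measurable E) (ED : E `<=` D) (n1 : (1 <= n)%N)
    (g h : 'I_n -> euclid R d -> R)
    (gL2 : forall i, L2 (leb R d) D (g i)) (gfree : lin_indep (leb R d) D g)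
    (hL2 : forall i, L2 (leb R d) E (h i)) (hfree : lin_indep (leb R d) E h)
    (phi : nat -> euclid R d -> R)
    (phi_basis : riesz_basis (leb R d) E
       (null_space (leb R d) D E (fredholm (leb R d) E g h)) phi)
    (f : euclid R d -> R) (fL2 : L2 (leb R d) D f) :
  let mu := leb R d in
  let L := fredholm mu E g h in
  let H := inner_mx mu E h h in
  let A := inner_mx mu E h g in
  let F := inner_col mu E f h in
  A \in unitmx ->
  ae_eq mu D f (fun x => ((invmx A *m F)^T *m vecfun g x) ord0 ord0) ->
  let udag := fun t => ((invmx H *m invmx A *m F)^T *m vecfun h t) ord0 ord0 in
  [/\ H \in unitmx,
      min_norm_solution mu D E L f udag /\
      (forall u, min_norm_solution mu D E L f u -> ae_eq mu E u udag),
      norm2 mu E udag ^+ 2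
        = ((invmx A *m F)^T *m invmx H *m (invmx A *m F)) ord0 ord0,
      (forall u, L2 mu E u ->
         (solutions mu D E L f u <->
          exists2 c, @l2seq R c & L2_sum mu E phi c (u \- udag)))
    & forall c, @l2seq R c ->
         exists2 u, L2 mu E u & L2_sum mu E phi c (u \- udag)].
Proof.
move=> mu L H A F _ fw udag.
have := degenerate_fredholm mD mE gL2 gfree hL2 hfree phi_basis fL2.
have vecE m (y : 'cV[R]_m) (k : 'I_m -> euclid R d -> R) t :
    (y^T *m vecfun k t) ord0 ord0 = \sum_i y i ord0 * k i t.
  by rewrite mxE; apply: eq_bigr => i _; rewrite !mxE.
move=> /(_ (invmx A *m F)); rewrite -/L -/H.
have -> : (fun t => \sum_i (invmx H *m (invmx A *m F)) i ord0 * h i t) = udag.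
  by apply/funext => t; rewrite -vecE mulmxA.
by apply; apply: filterS fw => x fx Dx; rewrite fx// vecE.
Qed.
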